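(* Let $R = k[x_1,\dots,x_n]$ be a polynomial ring over a field $k$. Let $I$ be a monomial ideal in $R$ and $x$ a variable of $R$ (one of $x_1,\dots,x_n$). Then (i) $\operatorname{reg} R/I = \operatorname{reg} R/(I:x)+1$ if $\operatorname{reg} R/(I:x) > \operatorname{reg} R/(I,x)$; (ii) $\operatorname{reg} R/I \in \{\operatorname{reg} R/(I,x)+1,\ \operatorname{reg} R/(I,x)\}$ if $\operatorname{reg} R/(I:x) = \operatorname{reg} R/(I,x)$; (iii) $\operatorname{reg} R/I = \operatorname{reg} R/(I,x)$ if $\operatorname{reg} R/(I:x) < \operatorname{reg} R/(I,x)$.
   Context: $R$ has the standard grading and $\mathfrak m=(x_1,\dots,x_n)$. For a finitely generated graded $R$-module $M$ with local cohomology modules $H^i_{\mathfrak m}(M)$, $\operatorname{reg} M := \max\{i+j \mid H^i_{\mathfrak m}(M)_j \neq 0\}$ (Castelnuovo-Mumford regularity). By the usual convention the zero module has regularity $-\infty$. $I:x=\{g\in R\mid gx\in I\}$ and $(I,x)=I+(x)$. *)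

(* Defs.v *)
(* [mpoly] has to be imported before [constructive_ereal]: in the other order
   their notations clash. *)
From HB Require Import structures.
From mathcomp Require Import all_boot all_order all_algebra.
From mathcomp Require Import zify.
From mathcomp Require Import mpoly.
From mathcomp Require Import boolp constructive_ereal.

Set Implicit Arguments.
Unset Strict Implicit.
Unset Printing Implicit Defensive.

Import Order.TTheory GRing.Theory Num.Theory.

Local Open Scope ring_scope.
Local Open Scope quotient_scope.

Section QuotientModule.
Variables (R : comNzRingType) (V : lmodType R) (N : submodClosed V).

(* [N] seen as a subgroup, for the library's quotient of abelian groups. *)
Definition msub : {pred V} := fun v => v \in N.

Let msub_zmod_closed : zmod_closed msub.
Proof. exact: GRing.submod_closedB (submodClosedP N). Qed.

HB.instance Definition _ := GRing.isZmodClosed.Build V msub msub_zmod_closed.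

Definition mquot : Type := Quotient.quot msub.
HB.instance Definition _ := GRing.Zmodule.on mquot.

Definition qproj (v : V) : mquot := \pi_mquot v.

Lemma qprojB : {morph qproj : v w / v - w}.
Proof. by move=> v w; rewrite /qproj raddfB. Qed.

Lemma qproj_eq v w : (qproj v = qproj w) <-> (v - w \in N).
Proof.
split=> [/eqP|H]; first by rewrite /qproj -Quotient.idealrBE.
by apply/eqP; rewrite /qproj -Quotient.idealrBE.
Qed.

Lemma qproj_surj q : exists v, q = qproj v.
Proof. by exists (repr q); rewrite /qproj reprK. Qed.

Definition mquot_scale (a : R) (q : mquot) : mquot :=
  qproj (a *: repr q).

Lemma mquot_scaleE a v : mquot_scale a (qproj v) = qproj (a *: v).
Proof.
apply/qproj_eq; rewrite -scalerBr rpredZ //.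
by apply/qproj_eq; rewrite /qproj reprK.
Qed.

Let scaleA a b q :
  mquot_scale a (mquot_scale b q) = mquot_scale (a * b) q.
Proof. by have [v ->] := qproj_surj q; rewrite !mquot_scaleE scalerA. Qed.

Let scale1 : left_id 1 mquot_scale.
Proof. by move=> q; have [v ->] := qproj_surj q; rewrite mquot_scaleE scale1r. Qed.

Let qprojD v w : qproj (v + w) = qproj v + qproj w.
Proof. by rewrite /qproj raddfD. Qed.

Let scaleDr : right_distributive mquot_scale +%R.
Proof.
move=> a p q; have [v ->] := qproj_surj p; have [w ->] := qproj_surj q.
by rewrite -qprojD !mquot_scaleE scalerDr qprojD.
Qed.

Let scaleDl q : {morph mquot_scale^~ q : a b / a + b}.
Proof.
by move=> a b; have [v ->] := qproj_surj q; rewrite !mquot_scaleE scalerDl qprojD.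
Qed.

HB.instance Definition _ :=
  GRing.Zmodule_isLmodule.Build R mquot scaleA scale1 scaleDr scaleDl.

End QuotientModule.

(* The localization M_u of M at {1, u, u^2, ...}, as an abelian group; the pair
   (m, s) stands for the fraction m / u^s. *)
Section Localization.
Variables (R : comNzRingType) (M : lmodType R) (u : R).

Definition loc_equiv (a b : M * nat) : bool :=
  `[< exists r, u ^+ (r + b.2) *: a.1 = u ^+ (r + a.2) *: b.1 >].

Let loc_refl : reflexive loc_equiv.
Proof. by move=> a; apply/asboolP; exists 0. Qed.

Let loc_sym : ssrbool.symmetric loc_equiv.
Proof. by move=> a b; apply/asboolP/asboolP => -[r H]; exists r. Qed.

Let loc_trans : transitive loc_equiv.
Proof.
move=> b a c /asboolP[r Hr] /asboolP[t Ht]; apply/asboolP.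
exists (r + t + b.2)%N.
have -> : (r + t + b.2 + c.2 = t + c.2 + (r + b.2))%N by lia.
have -> : (r + t + b.2 + a.2 = r + a.2 + (t + b.2))%N by lia.
rewrite (exprD u (t + c.2)) -scalerA Hr scalerA mulrC -scalerA Ht.
by rewrite scalerA -exprD.
Qed.

Canonical loc_equivRel := EquivRel loc_equiv loc_refl loc_sym loc_trans.

Definition loc : Type := {eq_quot loc_equiv}.
HB.instance Definition _ := Choice.on loc.
HB.instance Definition _ : EqQuotient _ loc_equiv loc := EqQuotient.on loc.

Definition locfrac (m : M) (s : nat) : loc := \pi_loc (m, s).

Lemma locfrac_eq m s m' s' : locfrac m s = locfrac m' s' <->
  exists r, u ^+ (r + s') *: m = u ^+ (r + s) *: m'.
Proof.
split=> [/eqP|H]; first by rewrite /locfrac eqmodE => /asboolP.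
by apply/eqP; rewrite /locfrac eqmodE; apply/asboolP.
Qed.

Lemma locfrac_surj q : exists m s, q = locfrac m s.
Proof.
by exists (repr q).1, (repr q).2; rewrite /locfrac -surjective_pairing reprK.
Qed.

Lemma locfrac_repr q : locfrac (repr q).1 (repr q).2 = q.
Proof. by rewrite /locfrac -surjective_pairing reprK. Qed.

Definition loc_add (p q : loc) : loc :=
  locfrac (u ^+ (repr q).2 *: (repr p).1 + u ^+ (repr p).2 *: (repr q).1)
       ((repr p).2 + (repr q).2).

Definition loc_opp (q : loc) : loc := locfrac (- (repr q).1) (repr q).2.

Lemma loc_addE m s m' s' : loc_add (locfrac m s) (locfrac m' s') =
  locfrac (u ^+ s' *: m + u ^+ s *: m') (s + s').
Proof.
have /locfrac_eq[r Hr] := locfrac_repr (locfrac m s).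
have /locfrac_eq[t Ht] := locfrac_repr (locfrac m' s').
rewrite /loc_add; set a := repr _ in Hr *; set b := repr _ in Ht *.
apply/locfrac_eq; exists (r + t)%N; rewrite !scalerDr !scalerA -!exprD.
have -> : (r + t + (s + s') + b.2 = t + s' + b.2 + (r + s))%N by lia.
have -> : (r + t + (s + s') + a.2 = r + s + a.2 + (t + s'))%N by lia.
rewrite (exprD _ _ (r + s)) (exprD _ _ (t + s')) -!scalerA Hr Ht.
by rewrite !scalerA -!exprD; congr (u ^+ _ *: _ + u ^+ _ *: _); lia.
Qed.

Lemma loc_oppE m s : loc_opp (locfrac m s) = locfrac (- m) s.
Proof.
have /locfrac_eq[r Hr] := locfrac_repr (locfrac m s).
by apply/locfrac_eq; exists r; rewrite !scalerN Hr.
Qed.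

Let addA : associative loc_add.
Proof.
move=> p q w; have [a [s ->]] := locfrac_surj p; have [b [t ->]] := locfrac_surj q.
have [c [e ->]] := locfrac_surj w; rewrite !loc_addE.
rewrite !scalerDr !scalerA -!exprD addrA addnA.
by congr (locfrac (u ^+ _ *: _ + u ^+ _ *: _ + u ^+ _ *: _) _); rewrite addnC.
Qed.

Let addC : commutative loc_add.
Proof.
move=> p q; have [a [s ->]] := locfrac_surj p; have [b [t ->]] := locfrac_surj q.
by rewrite !loc_addE addrC addnC.
Qed.

Let add0 : left_id (locfrac 0 0) loc_add.
Proof.
move=> p; have [a [s ->]] := locfrac_surj p.
by rewrite loc_addE scaler0 add0r expr0 scale1r.
Qed.

Let addN : left_inverse (locfrac 0 0) loc_opp loc_add.
Proof.
move=> p; have [a [s ->]] := locfrac_surj p.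
by rewrite loc_oppE loc_addE scalerN addNr; apply/locfrac_eq; exists 0; rewrite !scaler0.
Qed.

HB.instance Definition _ := GRing.isZmodule.Build loc addA addC add0 addN.

Lemma locfracD m s m' s' :
  locfrac m s + locfrac m' s' = locfrac (u ^+ s' *: m + u ^+ s *: m') (s + s').
Proof. exact: loc_addE. Qed.

Lemma locfracN m s : - locfrac m s = locfrac (- m) s.
Proof. exact: loc_oppE. Qed.

Lemma locfrac0 s : locfrac 0 s = 0.
Proof. by apply/locfrac_eq; exists 0; rewrite !scaler0. Qed.

End Localization.

Arguments locfrac {R M} u m s.

(* The canonical map M_u -> M_w when w = v * u, m / u^s |-> (v^s m) / w^s. *)
Definition loc_map (R : comNzRingType) (M : lmodType R) (u w v : R)
    (q : loc M u) : loc M w :=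
  locfrac w (v ^+ (repr q).2 *: (repr q).1) (repr q).2.

Lemma loc_mapE (R : comNzRingType) (M : lmodType R) (u w v : R) m s :
  w = v * u -> loc_map w v (locfrac u m s) = locfrac w (v ^+ s *: m) s :> loc M w.
Proof.
move=> ->; have /locfrac_eq[r Hr] := locfrac_repr (locfrac u m s).
rewrite /loc_map; set a := repr _ in Hr *.
apply/locfrac_eq; exists r; rewrite !scalerA !exprMn.
rewrite mulrAC -exprD -[LHS]scalerA Hr scalerA; congr (_ *: _).
by rewrite mulrAC -exprD; congr (v ^+ _ * _); lia.
Qed.

(* Local cohomology with support in (x_1, ..., x_n) of a graded module M over
   k[x_1, ..., x_n], as the cohomology of the Cech complex
     C^i = \bigoplus_(#|F| = i) M_(x_F),   x_F = \prod_(v in F) x_v.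
   The grading is given by its pieces: [Mdeg d m] means m \in M_d. *)
Section LocalCohomology.
Variables (k : fieldType) (n : nat) (M : lmodType {mpoly k[n]}).
Variable Mdeg : int -> M -> Prop.

Definition xprod (F : {set 'I_n}) : {mpoly k[n]} := \prod_(v in F) 'X_v.

Definition loc_deg (F : {set 'I_n}) (j : int) (q : loc M (xprod F)) : Prop :=
  exists m s, Mdeg (j + (s * #|F|)%N%:Z) m /\ q = locfrac (xprod F) m s.

(* All cohomological degrees together. *)
Definition cochain : Type := forall F : {set 'I_n}, loc M (xprod F).

(* The degree j piece of C^i. *)
Definition in_cech (i : nat) (j : int) (c : cochain) : Prop :=
  forall F : {set 'I_n}, if #|F| == i then loc_deg j (c F) else c F = 0.

Definition cech_d (c : cochain) : cochain := fun F =>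
  \sum_(v in F) loc_map (xprod F) 'X_v (c (F :\ v))
                  *~ (-1) ^+ #|[set w in F | (w < v)%N]|.

Definition cocycle (i : nat) (j : int) (c : cochain) : Prop :=
  in_cech i j c /\ forall F, cech_d c F = 0.

Definition coboundary (i : nat) (j : int) (c : cochain) : Prop :=
  if i is p.+1 then exists2 b, in_cech p j b & forall F, c F = cech_d b F
  else forall F, c F = 0.

(* H^i_m(M)_j != 0 *)
Definition local_cohomology_neq0 (i : nat) (j : int) : Prop :=
  exists2 c, cocycle i j c & ~ coboundary i j c.

End LocalCohomology.

(* The maximum of a set of integers: -oo if it is empty, +oo if it is unbounded
   above. *)
Definition is_max (S : int -> Prop) (r : \bar int) : Prop :=
  match r with
  | EFin m => S m /\ forall s, S s -> s <= m
  | +oo%E => forall b, exists2 s, S s & b < s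
  | -oo%E => forall s, ~ S s
  end.

Lemma is_max_exists S : exists r, is_max S r.
Proof.
have [[s0 Ss0]|S0] := pselect (exists s, S s); last first.
  by exists -oo%E => s Ss; apply: S0; exists s.
have [Sub|] := pselect (forall b, exists2 s, S s & b < s); first by exists +oo%E.
move=> /existsNP[b Hb].
have leb s : S s -> s <= b.
  by move=> Ss; rewrite leNgt; apply/negP => ltbs; apply: Hb; exists s.
have exP : exists m : nat, `[< S (b - m%:Z) >].
  exists `|b - s0|%N; apply/asboolP; rewrite gez0_abs ?subr_ge0 ?leb //.
  by rewrite opprB addrC subrK.
case: (ex_minnP exP) => m /asboolP Sm minm.
exists (b - m%:Z)%:E; split=> // s Ss.
have := leb _ Ss; rewrite -subr_ge0 => bs.
have /minm : `[< S (b - (`|b - s|%N)%:Z) >].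
  by apply/asboolP; rewrite gez0_abs // opprB addrC subrK.
by rewrite -lez_nat gez0_abs // => H; rewrite lerBrDl -lerBrDr.
Qed.

Lemma is_max_unique S r r' : is_max S r -> is_max S r' -> r = r'.
Proof.
case: r r' => [m||] [m'||] //=.
- move=> [Sm Hm] [Sm' Hm']; congr (_%:E).
  by apply/eqP; rewrite eq_le Hm // Hm'.
- by move=> [_ Hm] /(_ m)[s /Hm]; rewrite leNgt => /negP.
- by move=> [Sm _] /(_ m).
- by move=> /(_ m')[s Ss ltms] [_ /(_ _ Ss)]; rewrite leNgt ltms.
- by move=> /(_ 0)[s Ss _] /(_ s).
- by move=> H [/H].
- by move=> H /(_ 0)[s /H].
Qed.

(* Castelnuovo-Mumford regularity, max {i + j | H^i_m(M)_j != 0}. *)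
Definition reg_set (k : fieldType) (n : nat) (M : lmodType {mpoly k[n]})
    (Mdeg : int -> M -> Prop) (r : int) : Prop :=
  exists (i : nat) (j : int), local_cohomology_neq0 Mdeg i j /\ r = i%:Z + j.

Definition reg (k : fieldType) (n : nat) (M : lmodType {mpoly k[n]})
    (Mdeg : int -> M -> Prop) : \bar int :=
  sval (cid (is_max_exists (reg_set Mdeg))).

Lemma regP (k : fieldType) (n : nat) (M : lmodType {mpoly k[n]})
    (Mdeg : int -> M -> Prop) : is_max (reg_set Mdeg) (reg Mdeg).
Proof. exact: svalP. Qed.

(* Ideals of k[x_1, ..., x_n] (the unit ideal included) are the submodules of
   the regular module. *)
Notation ideal k n := (submodClosed {mpoly k[n]}^o).

Section Ideals.
Variables (k : fieldType) (n : nat).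
Local Notation R := {mpoly k[n]}.

Definition ideal_gen (G : R -> Prop) (p : R) : Prop :=
  exists s : seq (R * R),
    (forall t, t \in s -> G t.2) /\ p = \sum_(t <- s) t.1 * t.2.

Definition monomial_ideal (I : ideal k n) : Prop :=
  exists G : 'X_{1..n} -> Prop,
    forall p : R, p \in I <-> ideal_gen (fun q => exists2 m, G m & q = 'X_[m]) p.

Lemma ideal0 (I : ideal k n) : (0 : R) \in I.
Proof. exact: (GRing.submod_closedB (submodClosedP I)).1. Qed.

Lemma idealD (I : ideal k n) (p q : R) : p \in I -> q \in I -> p + q \in I.
Proof. by move=> Ip Iq; apply: (@rpredD R^o I). Qed.

Lemma idealMl (I : ideal k n) (a p : R) : p \in I -> a * p \in I.
Proof. by move=> Ip; apply: (@rpredZ R R^o I a p). Qed.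

(* I : x *)
Definition colon (I : ideal k n) (x : R) : {pred R^o} := fun g => (g : R) * x \in I.

Lemma colon_submod_closed I x : subsemimod_closed (colon I x).
Proof.
split; first split=> [|g h]; last move=> a g; rewrite !unfold_in /colon.
- by rewrite mul0r; apply: ideal0.
- by rewrite mulrDl; apply: idealD.
- by rewrite -[a *: g]/((a : R) * (g : R)) -mulrA; apply: idealMl.
Qed.

HB.instance Definition _ I x :=
  GRing.isSubmodClosed.Build R R^o (colon I x) (colon_submod_closed I x).

(* (I, x) = I + (x) *)
Definition add_elt (I : ideal k n) (x : R) : {pred R^o} :=
  fun g => `[< exists a h : R, a \in I /\ g = a + h * x >].

Lemma add_elt_submod_closed I x : subsemimod_closed (add_elt I x).
Proof.
split; first split=> [|g g']; last move=> c g; rewrite !unfold_in.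
- by apply/asboolP; exists 0, 0; split; [exact: ideal0|rewrite mul0r addr0].
- move=> /asboolP[a [h [Ia ->]]] /asboolP[a' [h' [Ia' ->]]]; apply/asboolP.
  by exists (a + a'), (h + h'); split; [exact: idealD|rewrite mulrDl addrACA].
- move=> /asboolP[a [h [Ia ->]]]; apply/asboolP; exists ((c : R) * a), (c * h).
  by split; [exact: idealMl|rewrite -mulrA -mulrDr].
Qed.

HB.instance Definition _ I x :=
  GRing.isSubmodClosed.Build R R^o (add_elt I x) (add_elt_submod_closed I x).

Definition poly_deg (d : int) (p : R) : Prop :=
  match d with Posz e => p \is e.-homog | Negz _ => p = 0 end.

(* (R/J)_d, the image of R_d *)
Definition quot_deg (J : ideal k n) (d : int) (q : mquot J) : Prop :=
  exists2 p : R, poly_deg d p & q = qproj J p.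

(* reg R/J *)
Definition reg_quot (J : ideal k n) : \bar int := reg (@quot_deg J).

End Ideals.

(* Main.v *)
From HB Require Import structures.
Require Import Defs.
From mathcomp Require Import all_boot all_order all_algebra.
From mathcomp Require Import zify ring.
From mathcomp Require Import mpoly.
From mathcomp Require Import boolp constructive_ereal.

Set Implicit Arguments.
Unset Strict Implicit.
Unset Printing Implicit Defensive.

Import Order.TTheory GRing.Theory Num.Theory.

Local Open Scope ring_scope.

(** The short exact sequence 0 -> R/(I:x)(-1) -> R/I -> R/(I,x) -> 0, whose first
    map is multiplication by x, induces a long exact sequence of local cohomology.
    Write A, M and B for the three quotients and call the sum i + j the weight of
    a nonzero H^i(-)_j.  The long exact sequence says that
    - a weight s of M is a weight of B, or s - 1 is a weight of A
      ([reg_set_quot]), so that reg M <= max (reg A + 1, reg B);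
    - if s is a weight of A, then s + 1 is a weight of M or s is a weight of B
      ([reg_set_colon]), so that reg M >= reg A + 1 when reg A > reg B.
    Together with reg B <= reg M, these inequalities give all three parts of the
    theorem.

    The inequality reg B <= reg M is where I has to be monomial: the weights of B
    are weights of M ([reg_set_add_elt]).  The substitution x := 0 maps a monomial
    ideal I into itself, hence it induces a section h : B -> M of the projection,
    linear over the polynomial ring in the other variables.  Let c be a Cech
    i-cocycle of B in degree j.  As x kills B, the cocycle c lives on the sets of
    variables that do not contain x, where h commutes with the Cech differential;
    so d (h c) lives on the sets that do contain x, where x acts invertibly, and
    (d (h c)) / x is an (i+1)-cocycle of M in degree j - 1.  Either its class is
    nonzero, and it has weight i + 1 + (j - 1) = i + j, or it equals d b, and then
    h c - x b is a cocycle of M that maps to c ([local_cohomology_split]).  In both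
    cases i + j is a weight of M.

    The comparison is between the sets of weights and not between their maxima,
    so that the values -oo and +oo of the regularity obey the same inequalities. *)

(** * Maps between localizations *)

Section LocalizationMaps.
Variable R : comNzRingType.

Lemma locfracB (M : lmodType R) (u : R) (m m' : M) s s' :
  locfrac u m s - locfrac u m' s' =
  locfrac u (u ^+ s' *: m - u ^+ s *: m') (s + s').
Proof. by rewrite locfracN locfracD scalerN. Qed.

Lemma locfrac_eq0 (M : lmodType R) (u : R) (m : M) s :
  locfrac u m s = 0 <-> exists r, u ^+ r *: m = 0.
Proof.
rewrite -(locfrac0 M u 0); split=> [/locfrac_eq[r]|[r Hr]].
  by rewrite addn0 scaler0; exists r.
by apply/locfrac_eq; exists r; rewrite addn0 scaler0.
Qed.

Lemma morphB_signed_sum (U V : zmodType) (f : U -> V) (I : finType)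
    (A : {pred I}) (F : I -> U) (e : I -> int) :
  {morph f : p q / p - q} ->
  f (\sum_(i in A) F i *~ e i) = \sum_(i in A) f (F i) *~ e i.
Proof.
move=> fB; pose g : {additive U -> V} :=
  HB.pack f (GRing.isZmodMorphism.Build U V f fB).
have fE p : f p = g p by [].
by rewrite fE raddf_sum; apply: eq_bigr => i _; rewrite raddfMz.
Qed.

Lemma morphB0 (U V : zmodType) (f : U -> V) :
  {morph f : p q / p - q} -> f 0 = 0.
Proof. by move=> fB; rewrite -(subrr 0) fB subrr. Qed.

Section LocMap.
Variables (M : lmodType R) (u v w : R).
Hypothesis wE : w = v * u.

Lemma loc_mapB : {morph @loc_map R M u w v : p q / p - q}.
Proof.
move=> p q; have [m [s ->]] := locfrac_surj p.
have [m' [s' ->]] := locfrac_surj q.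
rewrite locfracB !loc_mapE // locfracB scalerBr !scalerA.
by congr (locfrac w (_ *: _ - _ *: _) _); rewrite wE exprMn exprD; ring.
Qed.

Lemma loc_map0 : loc_map w v (0 : loc M u) = 0.
Proof. exact: morphB0 loc_mapB. Qed.

End LocMap.

Lemma loc_map_comp (M : lmodType R) (u v w v' w' : R) (q : loc M u) :
    w = v * u -> w' = v' * w ->
  loc_map w' v' (loc_map w v q) = loc_map w' (v' * v) q :> loc M w'.
Proof.
move=> wE w'E; have [m [s ->]] := locfrac_surj q.
by rewrite !loc_mapE // ?exprMn ?scalerA // w'E wE mulrA.
Qed.

Lemma morph_exp (M N : lmodType R) (u : R) (f : M -> N) s m :
  (forall m, f (u *: m) = u *: f m) -> f (u ^+ s *: m) = u ^+ s *: f m.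
Proof.
move=> fu; elim: s m => [|s IH] m; first by rewrite !expr0 !scale1r.
by rewrite !exprS -!scalerA fu IH.
Qed.

(** No linearity of [f] is built in: the substitution of zero for a variable
    induces maps of fractions although it commutes with only part of [R]. *)
Definition loc_fun (M N : lmodType R) (u : R) (f : M -> N) (q : loc M u) :
    loc N u :=
  locfrac u (f (repr q).1) (repr q).2.

Section LocFun.
Variables (M N : lmodType R) (u : R) (f : M -> N).
Hypothesis fB : {morph f : x y / x - y}.
Hypothesis fu : forall m, f (u *: m) = u *: f m.

Lemma loc_funE m s : loc_fun f (locfrac u m s) = locfrac u (f m) s.
Proof.
have /locfrac_eq[r Hr] := locfrac_repr (locfrac u m s).
by apply/locfrac_eq; exists r; rewrite -!(morph_exp _ _ fu) Hr.
Qed.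

Lemma loc_funB : {morph @loc_fun M N u f : p q / p - q}.
Proof.
move=> p q; have [m [s ->]] := locfrac_surj p.
have [m' [s' ->]] := locfrac_surj q.
by rewrite locfracB !loc_funE locfracB fB !(morph_exp _ _ fu).
Qed.

Lemma loc_fun_inj : (forall m, f m = 0 -> m = 0) ->
  forall q : loc M u, loc_fun f q = 0 -> q = 0.
Proof.
move=> f_inj q; have [m [s ->]] := locfrac_surj q; rewrite loc_funE.
case/locfrac_eq0 => r; rewrite -(morph_exp _ _ fu) => /f_inj H.
by apply/locfrac_eq0; exists r.
Qed.

Lemma loc_fun_map v w (q : loc M u) : w = v * u ->
    (forall m, f (v *: m) = v *: f m) ->
  loc_fun f (loc_map w v q) = loc_map w v (loc_fun f q).
Proof.
move=> wE fv; have [m [s ->]] := locfrac_surj q.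
have fw m' : f (w *: m') = w *: f m' by rewrite wE -!scalerA fv fu.
rewrite loc_funE !loc_mapE //.
have /locfrac_eq[r Hr] := locfrac_repr (locfrac w (v ^+ s *: m) s).
by apply/locfrac_eq; exists r; rewrite -(morph_exp _ _ fv) -!(morph_exp _ _ fw) Hr.
Qed.

End LocFun.

End LocalizationMaps.

(** * The Cech complex *)

Section CechComplex.
Variables (k : fieldType) (n : nat).
Local Notation R := {mpoly k[n]}.
Implicit Types (F G : {set 'I_n}) (v w : 'I_n).

Lemma xprod_setD1 F v : v \in F -> xprod k F = 'X_v * xprod k (F :\ v).
Proof. by move=> vF; rewrite /xprod (big_setD1 v). Qed.

(** The diagonal has its own hypothesis because antisymmetry does not make it
    vanish in characteristic two. *)
Lemma sum_antisym (U : zmodType) (A : {set 'I_n}) (E : 'I_n -> 'I_n -> U) :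
    {in A &, forall v w, E v w = - E w v} -> (forall v, E v v = 0) ->
  \sum_(v in A) \sum_(w in A) E v w = 0.
Proof.
move=> EN E0; pose H v w := if (v < w)%N then E v w else 0.
have EH v w : v \in A -> w \in A -> E v w = H v w - H w v.
  move=> vA wA; rewrite /H; case: ltngtP => [_|_|/val_inj->]; first by rewrite subr0.
    by rewrite sub0r -EN //.
  by rewrite E0 subrr.
rewrite (eq_bigr (fun v => \sum_(w in A) H v w - \sum_(w in A) H w v)); last first.
  by move=> v vA; rewrite -sumrB; apply: eq_bigr => w wA; apply: EH.
by rewrite sumrB [X in _ - X]exchange_big subrr.
Qed.

Definition cech_sign F v : int := (-1) ^+ #|[set w in F | (w < v)%N]|.

(** Removal of [v] lowers the position of [w] in [F] by one if [v < w], and keeps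
    it otherwise. *)
Lemma cech_sign_setD1 F v w : v \in F -> w != v ->
  cech_sign (F :\ v) w = (if (v < w)%N then - cech_sign F w else cech_sign F w).
Proof.
move=> vF wNv; rewrite /cech_sign; case: ltnP => [vw|wv].
  have -> : [set z in F | (z < w)%N] = v |: [set z in F :\ v | (z < w)%N].
    by apply/setP => z; rewrite !inE; case: eqVneq => //= ->; rewrite vF vw.
  by rewrite cardsU1 !inE eqxx /= add1n exprS mulN1r opprK.
congr (_ ^+ #|pred_of_set _|); apply/setP => z; rewrite !inE.
by case: eqVneq => //= ->; rewrite ltnNge wv andbF.
Qed.

Section Complex.
Variable M : lmodType R.
Implicit Types (c b : cochain M).

Lemma eq_cech_d c b F : (forall v, v \in F -> c (F :\ v) = b (F :\ v)) ->
  cech_d c F = cech_d b F.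
Proof. by move=> cb; apply: eq_bigr => v /cb->. Qed.

Lemma cech_dB c b F :
  cech_d (fun G => c G - b G) F = cech_d c F - cech_d b F.
Proof.
rewrite /cech_d -[RHS]sumrB; apply: eq_bigr => v vF.
by rewrite loc_mapB ?mulrzBl //; apply: xprod_setD1.
Qed.

Lemma cech_map_comp F v w (q : loc M (xprod k (F :\ v :\ w))) :
    v \in F -> w \in F -> w != v ->
  loc_map (xprod k F) 'X_v (loc_map (xprod k (F :\ v)) 'X_w q) =
  loc_map (xprod k F) ('X_v * 'X_w) q.
Proof.
move=> vF wF wv; apply: loc_map_comp; last exact: xprod_setD1.
by apply: xprod_setD1; rewrite !inE wv.
Qed.

(** The contributions of the removal of [v] then [w] and of [w] then [v] cancel,
    because the two orders differ in exactly one of the two signs. *)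
Lemma cech_dd c F : cech_d (cech_d c) F = 0.
Proof.
pose T v w := loc_map (xprod k F) ('X_v * 'X_w) (c (F :\ v :\ w)).
(* The two sets are equal but not convertible; the values of [c] on them become
   comparable once mapped to the common target [M_(x_F)]. *)
have TC v w : T v w = T w v.
  rewrite /T mulrC; have -> // : F :\ v :\ w = F :\ w :\ v.
  by rewrite !setDDl setUC.
pose E v w := if v == w then 0 else
  T v w *~ (cech_sign (F :\ v) w * cech_sign F v).
transitivity (\sum_(v in F) \sum_(w in F) E v w).
  apply: eq_bigr => v vF; rewrite morphB_signed_sum; last first.
    exact: loc_mapB (xprod_setD1 vF).
  rewrite [RHS](big_setD1 v) //= {1}/E eqxx add0r mulrz_suml.
  apply: eq_bigr => w; rewrite !inE => /andP[wv wF].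
  rewrite /E eq_sym (negbTE wv) mulrzA.
  by rewrite cech_map_comp.
apply: sum_antisym => [v w vF wF|v]; last by rewrite /E eqxx.
rewrite /E eq_sym; case: eqVneq => [_|wv]; first by rewrite oppr0.
rewrite TC -mulrNz; congr (_ *~ _).
have vw : v != w by rewrite eq_sym.
rewrite !cech_sign_setD1 //; case: ltngtP => [_|_|/val_inj E']; last first.
- by rewrite E' eqxx in vw.
- by rewrite mulNr opprK mulrC.
- by rewrite mulNr mulrC.
Qed.

End Complex.

(** * Gradings and local cohomology *)

(** The closure properties that make the pieces of one internal degree a subcomplex
    of the Cech complex. *)
Record graded (M : lmodType R) (Mdeg : int -> M -> Prop) : Prop := Graded {
  graded0 : forall d, Mdeg d 0;
  gradedB : forall d m m', Mdeg d m -> Mdeg d m' -> Mdeg d (m - m');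
  gradedX : forall d v m, Mdeg d m -> Mdeg (d + 1) ('X_v *: m) }.

Section Graded.
Variables (M : lmodType R) (Mdeg : int -> M -> Prop).
Hypothesis Mgr : graded Mdeg.

Lemma graded_xprod d F m : Mdeg d m -> Mdeg (d + #|F|%:Z) (xprod k F *: m).
Proof.
move Ec : #|F| => c; elim: c F Ec d m => [|c IH] F Ec d m dm.
  have -> : F = set0 by apply/eqP; rewrite -cards_eq0 Ec.
  by rewrite /xprod big_set0 scale1r addr0.
have /card_gt0P[v vF] : (0 < #|F|)%N by rewrite Ec.
rewrite (xprod_setD1 vF) -scalerA.
have -> : d + c.+1%:Z = d + c%:Z + 1 by lia.
apply: (gradedX Mgr); apply: IH => //.
by move: Ec; rewrite (cardsD1 v) vF => -[].
Qed.

Lemma graded_exp d e (u : R) s m :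
    (forall d m, Mdeg d m -> Mdeg (d + e%:Z) (u *: m)) ->
  Mdeg d m -> Mdeg (d + (s * e)%N%:Z) (u ^+ s *: m).
Proof.
move=> ue; elim: s d m => [|s IH] d m dm; first by rewrite expr0 scale1r addr0.
rewrite exprS -scalerA; have -> : d + (s.+1 * e)%N%:Z = d + (s * e)%N%:Z + e%:Z.
  by rewrite mulSn; lia.
exact/ue/IH.
Qed.

Lemma graded_xprod_exp d F s m :
  Mdeg d m -> Mdeg (d + (s * #|F|)%N%:Z) (xprod k F ^+ s *: m).
Proof. by apply: graded_exp => d' m' ?; apply: graded_xprod. Qed.

Lemma loc_deg0 F j : loc_deg Mdeg j (0 : loc M (xprod k F)).
Proof. by exists 0, 0; rewrite locfrac0; split=> //; apply: (graded0 Mgr). Qed.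

Lemma loc_degB F j (p q : loc M (xprod k F)) :
  loc_deg Mdeg j p -> loc_deg Mdeg j q -> loc_deg Mdeg j (p - q).
Proof.
move=> [m [s [dm ->]]] [m' [s' [dm' ->]]]; rewrite locfracB.
eexists _, _; split; last by [].
apply: (gradedB Mgr).
  have -> : j + ((s + s') * #|F|)%N%:Z = j + (s * #|F|)%N%:Z + (s' * #|F|)%N%:Z.
    by rewrite mulnDl; lia.
  exact: graded_xprod_exp.
have -> : j + ((s + s') * #|F|)%N%:Z = j + (s' * #|F|)%N%:Z + (s * #|F|)%N%:Z.
  by rewrite mulnDl; lia.
exact: graded_xprod_exp.
Qed.

Lemma loc_deg_signed_sum F j (A : {pred 'I_n}) (H : 'I_n -> loc M (xprod k F))
    (e : 'I_n -> nat) :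
    (forall v, v \in A -> loc_deg Mdeg j (H v)) ->
  loc_deg Mdeg j (\sum_(v in A) H v *~ (-1) ^+ e v).
Proof.
move=> dH; pose P (q : loc M (xprod k F)) := loc_deg Mdeg j q.
have PN q : P q -> P (- q) by rewrite -[- q]sub0r; apply/loc_degB/loc_deg0.
apply: (big_ind P); first exact: loc_deg0.
  by move=> p q Pp Pq; rewrite -[q]opprK; apply/loc_degB/PN.
move=> v vA; rewrite -signr_odd; case: odd; last exact: dH.
by rewrite expr1 mulrNz; apply/PN/dH.
Qed.

Lemma loc_deg_map F v j (q : loc M (xprod k (F :\ v))) : v \in F ->
  loc_deg Mdeg j q -> loc_deg Mdeg j (loc_map (xprod k F) 'X_v q).
Proof.
move=> vF [m [s [dm ->]]].
exists ('X_v ^+ s *: m), s; rewrite (loc_mapE _ _ (xprod_setD1 vF)); split=> //.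
have -> : j + (s * #|F|)%N%:Z = j + (s * #|F :\ v|)%N%:Z + (s * 1)%N%:Z.
  have -> : #|F| = (#|F :\ v|).+1 by rewrite (cardsD1 v F) vF.
  by rewrite mulnS muln1; lia.
by apply: graded_exp => // d' m'; apply: (gradedX Mgr).
Qed.

Lemma in_cech0 p j : in_cech Mdeg p j (fun F => 0).
Proof. by move=> F; case: eqP => // _; apply: loc_deg0. Qed.

Lemma in_cechB p j (c b : cochain M) :
  in_cech Mdeg p j c -> in_cech Mdeg p j b ->
  in_cech Mdeg p j (fun F => c F - b F).
Proof.
move=> cC bC F; have := cC F; have := bC F.
case: eqP => _; first by move=> db dc; apply: loc_degB.
by move=> -> ->; rewrite subrr.
Qed.

Lemma in_cech_d p j (c : cochain M) :
  in_cech Mdeg p j c -> in_cech Mdeg p.+1 j (cech_d c).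
Proof.
move=> cC F; have cardF v : v \in F -> (#|F :\ v| == p) = (#|F| == p.+1).
  by rewrite (cardsD1 v F) => ->.
case: ifP => Fp.
  apply: loc_deg_signed_sum => v vF; apply: loc_deg_map => //.
  by have := cC (F :\ v); rewrite cardF // Fp.
apply: big1 => v vF; have := cC (F :\ v); rewrite cardF // Fp => ->.
by rewrite loc_map0 ?mul0rz //; apply: xprod_setD1.
Qed.

Lemma coboundary_cocycle p j (c : cochain M) :
  coboundary Mdeg p j c -> cocycle Mdeg p j c.
Proof.
case: p => [|p] /= => [c0|[b bC cE]].
  have -> : c = fun=> 0 by apply: functional_extensionality_dep.
  split; first exact: in_cech0.
  move=> F; apply: big1 => v vF.
  by rewrite loc_map0 ?mul0rz //; apply: xprod_setD1.
have -> : c = cech_d b by apply: functional_extensionality_dep.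
by split; [exact: in_cech_d | exact: cech_dd].
Qed.

Lemma cocycleB p j (c b : cochain M) : cocycle Mdeg p j c ->
  cocycle Mdeg p j b -> cocycle Mdeg p j (fun F => c F - b F).
Proof.
move=> [cC dc] [bC db]; split; first exact: in_cechB.
by move=> F; rewrite cech_dB dc db subrr.
Qed.

Lemma coboundaryD p j (c b : cochain M) : coboundary Mdeg p j (fun F => c F - b F) ->
  coboundary Mdeg p j b -> coboundary Mdeg p j c.
Proof.
case: p => [|p] /=; first by move=> cb b0 F; rewrite -[c F](subrK (b F)) cb b0 addr0.
move=> [a aC aE] [a' a'C a'E].
exists (fun F => a F - (0 - a' F)).
  by apply: in_cechB => //; apply: in_cechB => //; apply: in_cech0.
have d0 F : cech_d (fun G => 0 : loc M (xprod k G)) F = 0.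
  by apply: big1 => v vF; rewrite loc_map0 ?mul0rz //; apply: xprod_setD1.
by move=> F; rewrite !cech_dB d0 sub0r opprK -aE -a'E subrK.
Qed.

End Graded.

(** * Maps of Cech complexes *)

(** Additive maps that commute with the variables in [A]: the linear maps are the
    case [A = setT], the linear maps over the subring without the variable ['X_i]
    are the case [A = [set~ i]]. *)
Record vars_linear (A : {set 'I_n}) (M N : lmodType R) (f : M -> N) : Prop :=
  VarsLinear {
    vars_linearB : {morph f : x y / x - y};
    vars_linearX : forall v m, v \in A -> f ('X_v *: m) = 'X_v *: f m }.

Definition cech_map (M N : lmodType R) (f : M -> N) (c : cochain M) : cochain N :=
  fun F => loc_fun f (c F).

Section CechMap.
Variables (A : {set 'I_n}) (M N : lmodType R) (f : M -> N).
Hypothesis fL : vars_linear A f.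

Lemma vars_linear_xprod F m : F \subset A -> f (xprod k F *: m) = xprod k F *: f m.
Proof.
move Ec : #|F| => c; elim: c F Ec m => [|c IH] F Ec m FA.
  have -> : F = set0 by apply/eqP; rewrite -cards_eq0 Ec.
  by rewrite /xprod big_set0 !scale1r.
have /card_gt0P[v vF] : (0 < #|F|)%N by rewrite Ec.
rewrite (xprod_setD1 vF) -!scalerA (vars_linearX fL) ?(subsetP FA) // IH //.
  by move: Ec; rewrite (cardsD1 v) vF => -[].
exact: subset_trans (subD1set _ _) FA.
Qed.

Lemma cech_mapE F m s : F \subset A ->
  loc_fun f (locfrac (xprod k F) m s) = locfrac (xprod k F) (f m) s.
Proof. by move=> FA; apply: loc_funE => m'; apply: vars_linear_xprod. Qed.

Lemma cech_mapB (F : {set 'I_n}) : F \subset A ->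
  {morph @loc_fun _ M N (xprod k F) f : p q / p - q}.
Proof.
move=> FA; apply: loc_funB; first exact: vars_linearB fL.
by move=> m; apply: vars_linear_xprod.
Qed.

Lemma cech_map0 F : F \subset A -> loc_fun f (0 : loc M (xprod k F)) = 0.
Proof. by move=> FA; apply: morphB0 (cech_mapB FA). Qed.

Lemma cech_map_d c F : F \subset A ->
  cech_map f (cech_d c) F = cech_d (cech_map f c) F.
Proof.
move=> FA; rewrite {1}/cech_map /cech_d morphB_signed_sum; last exact: cech_mapB.
apply: eq_bigr => v vF; congr (_ *~ _); apply: loc_fun_map.
- move=> m; apply: vars_linear_xprod; exact: subset_trans (subD1set _ _) FA.
- exact: xprod_setD1.
- by move=> m; apply: (vars_linearX fL); apply: (subsetP FA).
Qed.

Variables (Mdeg : int -> M -> Prop) (Ndeg : int -> N -> Prop) (e : int).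
Hypothesis fdeg : forall d m, Mdeg d m -> Ndeg (d + e) (f m).

Lemma loc_deg_fun F j (q : loc M (xprod k F)) : F \subset A ->
  loc_deg Mdeg j q -> loc_deg Ndeg (j + e) (loc_fun f q).
Proof.
move=> FA [m [s [dm ->]]]; exists (f m), s; split; last exact: cech_mapE.
by rewrite addrAC; apply: fdeg.
Qed.

End CechMap.

Section LinearMap.
Variables (M N : lmodType R) (f : M -> N).
Hypothesis fL : vars_linear setT f.
Variables (Mdeg : int -> M -> Prop) (Ndeg : int -> N -> Prop) (e : int).
Hypothesis fdeg : forall d m, Mdeg d m -> Ndeg (d + e) (f m).

Lemma in_cech_map p j c :
  in_cech Mdeg p j c -> in_cech Ndeg p (j + e) (cech_map f c).
Proof.
move=> cC F; have := cC F; case: eqP => _.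
  exact: (loc_deg_fun fL fdeg (subsetT F)).
by rewrite /cech_map => ->; apply: (cech_map0 fL (subsetT F)).
Qed.

Lemma cech_map_dT c : cech_map f (cech_d c) = cech_d (cech_map f c).
Proof.
apply: functional_extensionality_dep => F; apply: (cech_map_d fL _ (subsetT F)).
Qed.

Lemma cech_map_zero : cech_map f (fun=> 0) = fun=> 0.
Proof.
by apply: functional_extensionality_dep => F; apply: (cech_map0 fL (subsetT F)).
Qed.

Lemma cech_map_cocycle p j c :
  cocycle Mdeg p j c -> cocycle Ndeg p (j + e) (cech_map f c).
Proof.
move=> [cC dc]; split; first exact: in_cech_map.
move=> F; rewrite -cech_map_dT.
by rewrite /cech_map dc; apply: (cech_map0 fL (subsetT F)).
Qed.

Lemma cech_map_coboundary p j c :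
  coboundary Mdeg p j c -> coboundary Ndeg p (j + e) (cech_map f c).
Proof.
case: p => [|p] /= => [c0 F|[b bC cE]].
  by rewrite /cech_map c0; apply: (cech_map0 fL (subsetT F)).
exists (cech_map f b); first exact: in_cech_map.
have -> : c = cech_d b by apply: functional_extensionality_dep.
by rewrite cech_map_dT.
Qed.

End LinearMap.

(** * The long exact sequence *)

Section LongExactSequence.
Variables (M N P : lmodType R).
Variables (Mdeg : int -> M -> Prop) (Ndeg : int -> N -> Prop) (Pdeg : int -> P -> Prop).
Variables (e : int) (f : M -> N) (g : N -> P).
Hypothesis Ngr : graded Ndeg.
Hypotheses (fL : vars_linear setT f) (gL : vars_linear setT g).
Hypothesis fdeg : forall d m, Mdeg d m -> Ndeg (d + e) (f m).
Hypothesis gdeg : forall d m, Ndeg d m -> Pdeg (d + 0) (g m).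
Hypothesis f_inj : forall m, f m = 0 -> m = 0.
Hypothesis gf0 : forall m, g (f m) = 0.
Hypothesis exact_fg :
  forall d m, Ndeg d m -> g m = 0 -> exists2 a, Mdeg (d - e) a & m = f a.
Hypothesis g_surj : forall d p, Pdeg d p -> exists2 m, Ndeg d m & p = g m.

Lemma cech_map_inj c : cech_map f c = (fun=> 0) -> c = fun=> 0.
Proof.
move=> fc0; apply: functional_extensionality_dep => F.
have fc0F : loc_fun f (c F) = 0 by rewrite -[LHS]/(cech_map f c F) fc0.
apply: (loc_fun_inj _ f_inj fc0F) => m; exact: (vars_linear_xprod fL _ (subsetT F)).
Qed.

Lemma cech_map_fg c : cech_map g (cech_map f c) = fun=> 0.
Proof.
apply: functional_extensionality_dep => F; rewrite /cech_map.
have [m [s ->]] := locfrac_surj (c F).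
by rewrite (cech_mapE fL) ?(cech_mapE gL) ?subsetT // gf0 locfrac0.
Qed.

Lemma cech_lift p j (c : cochain P) : in_cech Pdeg p j c ->
  exists2 b, in_cech Ndeg p j b & cech_map g b = c.
Proof.
move=> cC; have lift F : exists b : loc N (xprod k F),
    (if #|F| == p then loc_deg Ndeg j b else b = 0) /\ loc_fun g b = c F.
  have := cC F; case: eqP => _.
    move=> [m [s [dm ->]]]; have [m' dm' ->] := g_surj dm.
    exists (locfrac (xprod k F) m' s); rewrite (cech_mapE gL) ?subsetT //.
    by split=> //; exists m', s.
  by move=> ->; exists 0; split=> //; apply: (cech_map0 gL (subsetT F)).
exists (fun F => projT1 (cid (lift F))) => [F|].
  by case: cid => b [].
by apply: functional_extensionality_dep => F; rewrite /cech_map; case: cid => b [].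
Qed.

(** A fraction that [g] kills has, after multiplication of numerator and
    denominator by a power of [x_F], a numerator that [g] kills; the exactness of
    the modules in each degree applies to that numerator. *)
Lemma cech_exact p j (c : cochain N) : in_cech Ndeg p j c ->
    cech_map g c = (fun=> 0) ->
  exists2 a, in_cech Mdeg p (j - e) a & cech_map f a = c.
Proof.
move=> cC gc0; have lift F : exists a : loc M (xprod k F),
    (if #|F| == p then loc_deg Mdeg (j - e) a else a = 0) /\ loc_fun f a = c F.
  have := cC F; case: eqP => _; last first.
    by move=> ->; exists 0; split=> //; apply: (cech_map0 fL (subsetT F)).
  move=> [m [s [dm cF]]].
  have : loc_fun g (c F) = 0 by rewrite -[LHS]/(cech_map g c F) gc0.
  rewrite cF (cech_mapE gL) ?subsetT // => /locfrac_eq0[r].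
  have gx m' : g (xprod k F *: m') = xprod k F *: g m'.
    exact: (vars_linear_xprod gL _ (subsetT F)).
  rewrite -(morph_exp _ _ gx); set m1 := _ ^+ r *: m => gm1.
  have dm1 := graded_xprod_exp Ngr F r dm.
  have [a da m1E] := exact_fg dm1 gm1.
  exists (locfrac (xprod k F) a (s + r)); split.
    exists a, (s + r)%N; split=> //; move: da.
    by congr (Mdeg _ a); rewrite mulnDl; lia.
  rewrite (cech_mapE fL) ?subsetT // -m1E; apply/locfrac_eq; exists 0.
  by rewrite scalerA -exprD !add0n.
exists (fun F => projT1 (cid (lift F))) => [F|].
  by case: cid => a [].
by apply: functional_extensionality_dep => F; rewrite /cech_map; case: cid => a [].
Qed.

Lemma coboundary_lift p j (c : cochain P) : coboundary Pdeg p j c ->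
  exists2 b, coboundary Ndeg p j b & cech_map g b = c.
Proof.
case: p => [|p] /= => [c0|[b bC cE]].
  exists (fun=> 0) => //; rewrite (cech_map_zero gL).
  by apply: functional_extensionality_dep => F; rewrite c0.
have [b' b'C b'E] := cech_lift bC.
exists (cech_d b'); first by exists b'.
by rewrite (cech_map_dT gL) b'E; apply: functional_extensionality_dep.
Qed.

Lemma cech_mapB_eq0 (c b : cochain N) : cech_map g c = cech_map g b ->
  cech_map g (fun F => c F - b F) = fun=> 0.
Proof.
move=> cb; apply: functional_extensionality_dep => F.
rewrite {1}/cech_map (cech_mapB gL) ?subsetT //.
by rewrite -[loc_fun g (c F)]/(cech_map g c F) cb subrr.
Qed.

Lemma cocycle_exact p j c a : cocycle Ndeg p j c -> in_cech Mdeg p (j - e) a ->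
  cech_map f a = c -> cocycle Mdeg p (j - e) a.
Proof.
move=> [cC dc] aC fa; split=> // F; apply: (congr1 (fun h => h F) (_ : _ = fun=> 0)).
apply: cech_map_inj; rewrite (cech_map_dT fL) fa.
exact: functional_extensionality_dep.
Qed.

(** The long exact sequence at [N].  If the image of the class in [P] is zero, then
    subtraction of a coboundary moves its representative into the image of [f],
    and [f] reflects cocycles because it is injective. *)
Lemma local_cohomology_middle p j : local_cohomology_neq0 Ndeg p j ->
  local_cohomology_neq0 Mdeg p (j - e) \/ local_cohomology_neq0 Pdeg p j.
Proof.
move=> [c cZ cNB].
have [gcB|gcNB] := pselect (coboundary Pdeg p j (cech_map g c)); last first.
  right; exists (cech_map g c) => //.
  by rewrite -[j]addr0; apply: (cech_map_cocycle gL gdeg).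
left; have [b bB bE] := coboundary_lift gcB.
have cbZ := cocycleB Ngr cZ (coboundary_cocycle Ngr bB).
have [a aC aE] := cech_exact cbZ.1 (cech_mapB_eq0 (esym bE)).
exists a; first exact: cocycle_exact cbZ aC aE.
move=> aB; apply: cNB; apply: (coboundaryD Ngr _ bB).
by rewrite -aE -[j](subrK e); apply: (cech_map_coboundary fL fdeg).
Qed.

(** The long exact sequence at [M].  If [f a] is the coboundary of [m], then [g m]
    is a cocycle of [P], the preimage of the class of [a] under the connecting
    homomorphism; were it a coboundary, [a] would be one too. *)
Lemma local_cohomology_left p j : local_cohomology_neq0 Mdeg p (j - e) ->
  local_cohomology_neq0 Ndeg p j \/
  exists2 q, p = q.+1 & local_cohomology_neq0 Pdeg q j.
Proof.
move=> [a aZ aNB].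
have faZ : cocycle Ndeg p j (cech_map f a).
  by rewrite -[j](subrK e); apply: (cech_map_cocycle fL fdeg).
have [faB|faNB] := pselect (coboundary Ndeg p j (cech_map f a)); last first.
  by left; exists (cech_map f a).
right; case: p => [|q] in aZ aNB faZ faB *.
  case: aNB => F; apply: (congr1 (fun h => h F) (_ : _ = fun=> 0)).
  exact/cech_map_inj/functional_extensionality_dep.
exists q => //; case: faB => m mC faE.
have {}faE : cech_map f a = cech_d m by apply: functional_extensionality_dep.
have gmZ : cocycle Pdeg q j (cech_map g m).
  split; first by rewrite -[j]addr0; apply: (in_cech_map gL gdeg).
  by move=> F; rewrite -(cech_map_dT gL) -faE cech_map_fg.
exists (cech_map g m) => // gmB; apply: aNB.
have [b bB bE] := coboundary_lift gmB.
have [bC db] := coboundary_cocycle Ngr bB.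
have [a' a'C a'E] := cech_exact (in_cechB Ngr mC bC) (cech_mapB_eq0 (esym bE)).
exists a' => // F; apply: subr0_eq.
have : (fun F => a F - cech_d a' F) = fun=> 0; last first.
  by move=> H; rewrite -[LHS]/((fun F => a F - cech_d a' F) F) H.
apply: cech_map_inj; apply: functional_extensionality_dep => G.
rewrite /cech_map (cech_mapB fL) ?subsetT //.
rewrite -[loc_fun f (a G)]/(cech_map f a G) faE.
rewrite -[loc_fun f (cech_d a' G)]/(cech_map f (cech_d a') G).
by rewrite (cech_map_dT fL) a'E cech_dB db subr0 subrr.
Qed.

End LongExactSequence.

(** * Quotients that admit a section *)

Section SplitQuotient.
Variables (i : 'I_n) (M P : lmodType R).
Variables (Mdeg : int -> M -> Prop) (Pdeg : int -> P -> Prop).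
Variables (g : M -> P) (h : P -> M).
Hypothesis Mgr : graded Mdeg.
Hypotheses (gL : vars_linear setT g) (hL : vars_linear [set~ i] h).
Hypothesis gdeg : forall d m, Mdeg d m -> Pdeg (d + 0) (g m).
Hypothesis hdeg : forall d m, Pdeg d m -> Mdeg (d + 0) (h m).
Hypothesis hK : forall p, g (h p) = p.
Hypothesis XiP : forall p : P, 'X_i *: p = 0.

Let mulX (m : M) : M := 'X_i *: m.

Lemma mulX_linear : vars_linear setT mulX.
Proof.
split=> [m m'|v m _]; rewrite /mulX ?scalerBr //.
by rewrite !scalerA mulrC.
Qed.

Lemma mulX_deg d m : Mdeg d m -> Mdeg (d + 1) (mulX m).
Proof. exact: (gradedX Mgr). Qed.

Lemma loc_P_eq0 F (q : loc P (xprod k F)) : i \in F -> q = 0.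
Proof.
move=> iF; have [m [s ->]] := locfrac_surj q.
apply/locfrac_eq0; exists 1%N.
by rewrite expr1 (xprod_setD1 iF) mulrC -scalerA XiP scaler0.
Qed.

(** On [M_(x_F)] with [i] in [F], the fraction [x_(F :\ i) / x_F] is an inverse of
    ['X_i]. *)
Lemma mulX_loc_inj F (q : loc M (xprod k F)) : i \in F -> loc_fun mulX q = 0 -> q = 0.
Proof.
move=> iF; have [m [s ->]] := locfrac_surj q.
rewrite (cech_mapE mulX_linear) ?subsetT // => /locfrac_eq0[r Hr].
apply/locfrac_eq0; exists r.+1.
rewrite exprS {1}(xprod_setD1 iF) -mulrA mulrCA ['X_i * _]mulrC.
by rewrite -!scalerA Hr scaler0.
Qed.

Lemma mulX_loc_surj F j (q : loc M (xprod k F)) : i \in F -> loc_deg Mdeg j q ->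
  exists2 q', loc_deg Mdeg (j - 1) q' & loc_fun mulX q' = q.
Proof.
move=> iF [m [s [dm ->]]].
exists (locfrac (xprod k F) (xprod k (F :\ i) *: m) s.+1).
  eexists _, _; split; last by [].
  have -> : j - 1 + (s.+1 * #|F|)%N%:Z = j + (s * #|F|)%N%:Z + #|F :\ i|%:Z.
    have -> : #|F| = (#|F :\ i|).+1 by rewrite (cardsD1 i F) iF.
    by rewrite mulSn; lia.
  exact: graded_xprod.
rewrite (cech_mapE mulX_linear) ?subsetT // /mulX scalerA -(xprod_setD1 iF).
by apply/locfrac_eq; exists 0; rewrite scalerA -exprSr.
Qed.

(** Let the cocycle [c] of [P] represent a class.  The coboundary of its image
    under the section is supported on the sets that contain [i], where ['X_i] is
    invertible, and division by ['X_i] makes of it a cocycle [e] of degree one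
    less.  If [e] is the coboundary of [b], then the class of [c] lifts to [M]:
    subtraction of ['X_i] times [b] turns the image of [c] into a cocycle and does
    not change its residue in [P], which ['X_i] annihilates. *)
Lemma local_cohomology_split p j : local_cohomology_neq0 Pdeg p j ->
  local_cohomology_neq0 Mdeg p j \/ local_cohomology_neq0 Mdeg p.+1 (j - 1).
Proof.
move=> [c [cC dc] cNB].
have sub_i F : i \notin F -> F \subset [set~ i].
  by move=> iF; apply/subsetP => v vF; rewrite !inE; apply: contraNneq iF => <-.
(* [h] does not commute with ['X_i], so it may send a representative of zero to a
   nonzero fraction when [i] is in [F]; there the value is set to zero. *)
pose hc : cochain M := fun F => if i \in F then 0 else loc_fun h (c F).
have hcC : in_cech Mdeg p j hc.
  move=> F; have := cC F; rewrite /hc; case: ifP => _; case: ifP => iF.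
  - by move=> _; apply: (loc_deg0 Mgr).
  - rewrite -{2}[j]addr0; apply: (loc_deg_fun hL hdeg); apply: sub_i.
    by rewrite iF.
  - by [].
  - by move=> ->; apply: (cech_map0 hL); apply: sub_i; rewrite iF.
have dhc F : i \notin F -> cech_d hc F = 0.
  move=> iF; rewrite (eq_cech_d (b := cech_map h c)); last first.
    by move=> v vF; rewrite /hc !inE (negbTE iF) andbF.
  rewrite -(cech_map_d hL) ?sub_i // /cech_map dc.
  by apply: (cech_map0 hL); apply: sub_i.
(* [cech_d hc F] divided by ['X_i] *)
have quo F : exists q : loc M (xprod k F),
    [/\ (if #|F| == p.+1 then loc_deg Mdeg (j - 1) q else q = 0),
        loc_fun mulX q = cech_d hc F & i \notin F -> q = 0].
  have mulX0 := cech_map0 mulX_linear (subsetT F).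
  have := in_cech_d Mgr hcC F; case: ifP => _; last first.
    by move=> ->; exists 0.
  have [iF|iF] := boolP (i \in F); last first.
    by move=> _; exists 0; rewrite dhc //; split=> //; apply: (loc_deg0 Mgr).
  by case/(mulX_loc_surj iF) => q dq qE; exists q.
pose e : cochain M := fun F => projT1 (cid (quo F)).
have eP F : [/\ (if #|F| == p.+1 then loc_deg Mdeg (j - 1) (e F) else e F = 0),
    loc_fun mulX (e F) = cech_d hc F & i \notin F -> e F = 0].
  exact: projT2 (cid (quo F)).
have eE : cech_map mulX e = cech_d hc.
  by apply: functional_extensionality_dep => F; have [_ H _] := eP F.
have eZ : cocycle Mdeg p.+1 (j - 1) e.
  split=> F; first by have [H _ _] := eP F.
  have [iF|iF] := boolP (i \in F); last first.
    apply: big1 => v vF; have [_ _ ->] := eP (F :\ v).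
      by rewrite loc_map0 ?mul0rz //; apply: xprod_setD1.
    by rewrite !inE (negbTE iF) andbF.
  apply: (mulX_loc_inj iF).
  rewrite -[LHS]/(cech_map mulX (cech_d e) F) (cech_map_dT mulX_linear) eE.
  exact: cech_dd.
have [eB|eNB] := pselect (coboundary Mdeg p.+1 (j - 1) e); last by right; exists e.
left; case: eB => b bC bE.
have {}bE : e = cech_d b by apply: functional_extensionality_dep.
pose y : cochain M := fun F => hc F - cech_map mulX b F.
have gy : cech_map g y = c.
  apply: functional_extensionality_dep => F.
  have [iF|iF] := boolP (i \in F); first by rewrite [RHS]loc_P_eq0 // [LHS]loc_P_eq0.
  rewrite /cech_map /y (cech_mapB gL) ?subsetT // /hc (negbTE iF).
  have [m [s ->]] := locfrac_surj (c F).
  rewrite (cech_mapE hL) ?sub_i // (cech_mapE gL) ?subsetT // hK /cech_map.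
  have [m' [s' ->]] := locfrac_surj (b F).
  rewrite (cech_mapE mulX_linear) ?subsetT // (cech_mapE gL) ?subsetT //.
  by rewrite /mulX (vars_linearX gL) ?inE // XiP locfrac0 subr0.
exists y; last first.
  move=> yB; apply: cNB; rewrite -gy -[j]addr0.
  exact: (cech_map_coboundary gL gdeg).
split.
  apply: (in_cechB Mgr) => //; rewrite -[j](subrK 1).
  exact: (in_cech_map mulX_linear mulX_deg).
by move=> F; rewrite cech_dB -(cech_map_dT mulX_linear) -bE eE subrr.
Qed.

End SplitQuotient.

End CechComplex.

(** * Setting a variable to zero *)

Section SetVariableToZero.
Variables (k : fieldType) (n : nat) (i : 'I_n).
Local Notation R := {mpoly k[n]}.
Implicit Types (p q : R).

Definition set_var0 p : R := p \mPo [tuple if j == i then 0 else 'X_j | j < n].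

Lemma set_var0B : {morph set_var0 : p q / p - q}.
Proof. by move=> p q; rewrite /set_var0 raddfB. Qed.

Lemma set_var0M : {morph set_var0 : p q / p * q}.
Proof. by move=> p q; rewrite /set_var0 rmorphM. Qed.

Lemma set_var0_sum (T : Type) (s : seq T) (F : T -> R) :
  set_var0 (\sum_(t <- s) F t) = \sum_(t <- s) set_var0 (F t).
Proof. by rewrite /set_var0 raddf_sum. Qed.

Lemma set_var0_monomial m :
  set_var0 'X_[m] = if m i == 0%N then 'X_[m] else 0.
Proof.
rewrite /set_var0 comp_mpolyX [in RHS]mpolyXE_id; case: eqP => [mi0|/eqP mi_neq0].
  apply: eq_bigr => j _; rewrite tnth_mktuple.
  by case: eqP => // ->; rewrite mi0 !expr0.
by rewrite (bigD1 i) //= tnth_mktuple eqxx expr0n (negbTE mi_neq0) mul0r.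
Qed.

Lemma set_var0_var j : set_var0 'X_j = if j == i then 0 else 'X_j.
Proof.
by rewrite set_var0_monomial mnm1E eqb0; case: eqP.
Qed.

Lemma set_var0E p :
  set_var0 p = \sum_(m <- msupp p) p@_m *: set_var0 'X_[m].
Proof. exact: comp_mpolyEX. Qed.

Lemma set_var0_dvd p : exists q, p - set_var0 p = q * 'X_i.
Proof.
rewrite set_var0E {1}[p]mpolyE -sumrB.
exists (\sum_(m <- msupp p) if m i == 0%N then 0 else p@_m *: 'X_[m - U_(i)]).
rewrite mulr_suml; apply: eq_bigr => m _; rewrite set_var0_monomial.
case: eqP => [_|/eqP mi]; first by rewrite subrr mul0r.
have Ui : (U_(i) <= m)%MM.
  by apply/mnm_lepP => j; rewrite mnm1E; case: eqP => [<-|//]; rewrite lt0n.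
by rewrite scaler0 subr0 -scalerAl -mpolyXD submK.
Qed.

Lemma set_var0_deg d p : poly_deg d p -> poly_deg d (set_var0 p).
Proof.
case: d => d /= => [dp|->]; last by rewrite /set_var0 raddf0.
rewrite set_var0E big_seq rpred_sum // => m mp; apply: rpredZ.
rewrite set_var0_monomial; case: ifP => _; last exact: rpred0.
by rewrite dhomogX; apply/eqP; apply: (dhomog_mf dp).
Qed.

Lemma poly_deg0 d : poly_deg d (0 : R).
Proof. by case: d => d //=; apply: rpred0. Qed.

Lemma poly_degB d p q : poly_deg d p -> poly_deg d q -> poly_deg d (p - q).
Proof. by case: d => d /=; [apply: rpredB | move=> -> ->; rewrite subrr]. Qed.

Lemma poly_degX d v p : poly_deg d p -> poly_deg (d + 1) ('X_v * p).
Proof.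
case: d => [d dp|d pE].
  rewrite -PoszD /= addnC; apply: dhomogM => //.
  by rewrite dhomogX; apply/eqP/mdeg1.
by rewrite [p]pE mulr0; apply: poly_deg0.
Qed.

Lemma poly_deg_div d v q : poly_deg d (q * 'X_v) -> poly_deg (d - 1) q.
Proof.
case: d => [d|d] dq; last first.
  have Xv : 'X_v != 0 :> R by rewrite -msupp_eq0 msuppX.
  have -> : q = 0 by apply: (mulIf Xv); rewrite dq mul0r.
  exact: poly_deg0.
have degq m : m \in msupp q -> (mdeg m).+1 = d.
  move=> mq; have mvq : (U_(v) + m)%MM \in msupp (q * 'X_v).
    by rewrite mcoeff_msupp mcoeffMX -mcoeff_msupp.
  have : mdeg (U_(v) + m) = d := dhomog_mf dq mvq.
  by rewrite mdegD mdeg1 add1n.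
case: d => [|d] in dq degq *.
  suff -> : q = 0 by [].
  apply/eqP; rewrite -msupp_eq0; case: (msupp q) degq => // m s degq.
  by have := degq m (mem_head _ _).
rewrite -addn1 PoszD addrK /=; apply/dhomogP => m mq.
by have [] := degq m mq.
Qed.

(** The substitution fixes a monomial generator or sends it to zero. *)
Lemma set_var0_monomial_ideal (I : ideal k n) p :
  monomial_ideal I -> p \in I -> set_var0 p \in I.
Proof.
move=> [G IG] /IG[s [Gs ->]]; rewrite set_var0_sum big_seq.
apply: (big_ind (fun q : R => q \in I)) => [||t ts].
- exact: ideal0.
- exact: idealD.
rewrite set_var0M; apply: idealMl; have [m Gm ->] := Gs t ts.
rewrite set_var0_monomial; case: ifP => _; last exact: ideal0.
apply/IG; exists [:: (1, 'X_[m])]; split; last by rewrite big_seq1 mul1r.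
by move=> t'; rewrite inE => /eqP->; exists m.
Qed.

End SetVariableToZero.

(** * The modules R/(I:x), R/I and R/(I,x) *)

Section Quotients.
Variables (k : fieldType) (n : nat).
Local Notation R := {mpoly k[n]}.

Lemma qproj_eq0 (J : ideal k n) (p : R) : qproj J p = 0 <-> p \in J.
Proof.
have <- : qproj J 0 = 0 by rewrite -[0 in LHS](subrr 0) qprojB subrr.
by rewrite qproj_eq subr0.
Qed.

Lemma qprojX (J : ideal k n) v (p : R) : 'X_v *: qproj J p = qproj J ('X_v * p).
Proof. exact: mquot_scaleE. Qed.

Lemma quot_deg_graded (J : ideal k n) : graded (@quot_deg k n J).
Proof.
split=> [d|d _ _ [p dp ->] [q dq ->]|d v _ [p dp ->]].
- exists 0; first exact: poly_deg0.
  by apply/esym/qproj_eq0/ideal0.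
- by exists (p - q : R); [exact: poly_degB | rewrite qprojB].
- by exists ('X_v * p); [exact: poly_degX | rewrite qprojX].
Qed.

Definition quot_fun (J J' : ideal k n) (f : R -> R) (q : mquot J) : mquot J' :=
  qproj J' (f (repr q : R)).
Arguments quot_fun : clear implicits.

Section QuotFun.
Variables (J J' : ideal k n) (f : R -> R).
Hypothesis fB : {morph f : p q / p - q}.
Hypothesis fJ : forall p, p \in J -> f p \in J'.

Lemma quot_funE p : quot_fun J J' f (qproj J p) = qproj J' (f p).
Proof.
apply/qproj_eq; rewrite -[_ - _]fB; apply: fJ.
by apply/qproj_eq; rewrite /qproj reprK.
Qed.

Lemma quot_fun_linear (A : {set 'I_n}) :
    (forall v p, v \in A -> f ('X_v * p) = 'X_v * f p) ->
  vars_linear A (quot_fun J J' f).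
Proof.
move=> fX; split=> [p q|v q vA].
  have [{}p ->] := qproj_surj p; have [{}q ->] := qproj_surj q.
  by rewrite -qprojB !quot_funE -qprojB -fB.
have [p ->] := qproj_surj q.
by rewrite qprojX !quot_funE qprojX fX.
Qed.

Lemma quot_fun_deg e : (forall d p, poly_deg d p -> poly_deg (d + e) (f p)) ->
  forall d q, quot_deg d q -> quot_deg (d + e) (quot_fun J J' f q).
Proof. by move=> fd d _ [p dp ->]; exists (f p); [exact: fd | rewrite quot_funE]. Qed.

End QuotFun.

Section MonomialIdeal.
Variables (I : ideal k n) (i : 'I_n).
Hypothesis monI : monomial_ideal I.
Let x : R := 'X_i.

Let mulx : R -> R := fun p => x * p.

Let mulxB : {morph mulx : p q / p - q}.
Proof. by move=> p q; rewrite /mulx mulrBr. Qed.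

Let mulx_colon p : p \in colon I x -> mulx p \in I.
Proof. by rewrite unfold_in /mulx mulrC. Qed.

Let mulxX v p : v \in setT -> mulx ('X_v * p) = 'X_v * mulx p.
Proof. by move=> _; rewrite /mulx mulrCA. Qed.

Let idB : {morph @id R : p q / p - q}. Proof. by []. Qed.

Let sub_add_elt p : p \in I -> p \in add_elt I x.
Proof.
by move=> Ip; apply/asboolP; exists p, 0; split=> //; rewrite mul0r addr0.
Qed.

Let x_add_elt p : p * x \in add_elt I x.
Proof.
by apply/asboolP; exists 0, p; split; [exact: ideal0 | rewrite add0r].
Qed.

(** The section of [R/I -> R/(I,x)] is well defined: [x] goes to zero and [I] into
    itself. *)
Let set_var0_add_elt p : p \in add_elt I x -> set_var0 i p \in I.
Proof.
move=> /asboolP[a [h [Ia ->]]].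
rewrite -[h * x]opprK set_var0B -[- (h * x)]sub0r set_var0B set_var0M.
rewrite [set_var0 i x]set_var0_var eqxx mulr0 subr0.
rewrite /set_var0 raddf0 subr0; exact: set_var0_monomial_ideal.
Qed.

Let f := quot_fun (colon I x) I mulx.
Let g := quot_fun I (add_elt I x) id.
Let h := quot_fun (add_elt I x) I (set_var0 i).

Let fE p : f (qproj _ p) = qproj I (x * p).
Proof. exact: (quot_funE mulxB mulx_colon). Qed.

Let gE p : g (qproj _ p) = qproj (add_elt I x) p.
Proof. exact: (quot_funE idB sub_add_elt). Qed.

Let hE p : h (qproj _ p) = qproj I (set_var0 i p).
Proof. exact: (quot_funE (@set_var0B k n i) set_var0_add_elt). Qed.

Let fL : vars_linear setT f.
Proof. exact: quot_fun_linear. Qed.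

Let gL : vars_linear setT g.
Proof. exact: quot_fun_linear. Qed.

Let hL : vars_linear [set~ i] h.
Proof.
apply: (quot_fun_linear (@set_var0B k n i) set_var0_add_elt) => v p.
by rewrite !inE set_var0M set_var0_var => /negbTE->.
Qed.

Let fdeg d m : quot_deg d m -> quot_deg (d + 1) (f m).
Proof. by apply: quot_fun_deg => // d' p; apply: poly_degX. Qed.

Let gdeg d m : quot_deg d m -> quot_deg (d + 0) (g m).
Proof. by apply: quot_fun_deg => // d' p; rewrite addr0. Qed.

Let hdeg d m : quot_deg d m -> quot_deg (d + 0) (h m).
Proof.
apply: (quot_fun_deg (@set_var0B k n i) set_var0_add_elt) => d' p.
by rewrite addr0; apply: set_var0_deg.
Qed.

Let f_inj m : f m = 0 -> m = 0.
Proof.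
have [p ->] := qproj_surj m; rewrite fE => /qproj_eq0 Ip; apply/qproj_eq0.
by rewrite unfold_in mulrC.
Qed.

Let gf0 m : g (f m) = 0.
Proof.
have [p ->] := qproj_surj m; rewrite fE gE; apply/qproj_eq0.
by rewrite /mulx mulrC.
Qed.

(** If [p] lies in [(I,x)], then its value at [x := 0] lies in [I], so [p] is
    congruent modulo [I] to the rest, which is a multiple of [x]. *)
Let exact_fg d m : quot_deg d m -> g m = 0 ->
  exists2 a, quot_deg (d - 1) a & m = f a.
Proof.
move=> [p dp ->]; rewrite gE => /qproj_eq0 /set_var0_add_elt Ip0.
have [q qE] := set_var0_dvd i p.
exists (qproj (colon I x) q).
  exists q => //; apply: (@poly_deg_div _ _ d i); rewrite -qE.
  by apply: poly_degB => //; apply: set_var0_deg.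
rewrite fE; apply/qproj_eq; rewrite /mulx mulrC -qE.
by rewrite opprB addrC subrK.
Qed.

Let g_surj d p : quot_deg d p -> exists2 m, quot_deg d m & p = g m.
Proof. by move=> [q dq ->]; exists (qproj I q); [exists q | rewrite gE]. Qed.

Let hK p : g (h p) = p.
Proof.
have [q ->] := qproj_surj p; rewrite hE gE; apply/esym/qproj_eq.
by have [r ->] := set_var0_dvd i q.
Qed.

Let XiP (p : mquot (add_elt I x)) : 'X_i *: p = 0.
Proof.
by have [q ->] := qproj_surj p; rewrite qprojX mulrC; apply/qproj_eq0.
Qed.

Lemma reg_set_quot s : reg_set (@quot_deg k n I) s ->
  reg_set (@quot_deg k n (colon I x)) (s - 1) \/
  reg_set (@quot_deg k n (add_elt I x)) s.
Proof.
move=> [p [j [H ->]]].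
case: (local_cohomology_middle (quot_deg_graded I) fL gL fdeg gdeg f_inj exact_fg
  g_surj H) => {}H; [left | right].
  by exists p, (j - 1); split=> //; rewrite addrA.
by exists p, j.
Qed.

Lemma reg_set_colon s : reg_set (@quot_deg k n (colon I x)) s ->
  reg_set (@quot_deg k n I) (s + 1) \/ reg_set (@quot_deg k n (add_elt I x)) s.
Proof.
move=> [p [j [H ->]]]; rewrite -[j](addrK 1) in H.
case: (local_cohomology_left (quot_deg_graded I) fL gL fdeg gdeg f_inj gf0
  exact_fg g_surj H) => [{}H|[q -> {}H]]; [left | right].
  by exists p, (j + 1); split=> //; rewrite addrA.
by exists q, (j + 1); split=> //; lia.
Qed.

(** In the second alternative of [local_cohomology_split] the cohomological degree
    rises by one and the internal degree drops by one: their sum is unchanged. *)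
Lemma reg_set_add_elt s : reg_set (@quot_deg k n (add_elt I x)) s ->
  reg_set (@quot_deg k n I) s.
Proof.
move=> [p [j [H ->]]].
case: (local_cohomology_split (quot_deg_graded I) gL hL gdeg hdeg hK XiP H) => {}H.
  by exists p, j.
by exists p.+1, (j - 1); split=> //; lia.
Qed.

End MonomialIdeal.
End Quotients.

(** * Maxima of sets of integers *)

Lemma int_succ_le (a b : \bar int) : (a < b -> a + 1%:E <= b)%E.
Proof.
case: a b => [a||] [b||] //=; last by rewrite leey.
by rewrite lte_fin lee_fin lezD1.
Qed.

Section MaximumBounds.
Variables (S : int -> Prop) (r : \bar int).
Hypothesis Smax : is_max S r.
Local Open Scope ereal_scope.

Lemma is_max_ub s : S s -> s%:E <= r.
Proof.
case: r Smax => [m [_ H] /H|_ _|H /H] //; last by rewrite leey.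
Qed.

Lemma is_max_least (t : \bar int) : (forall s, S s -> s%:E <= t) -> r <= t.
Proof.
case: r Smax => [m [Sm _] H|H Ht|_ _]; [exact: H | | exact: leNye].
case: t Ht => [t Ht||Ht]; last 2 first.
- by [].
- by have [s /Ht] := H 0%R.
by have [s /Ht] := H t; rewrite lee_fin leNgt => /negP.
Qed.

End MaximumBounds.

(** [A], [S] and [B] stand for the sets of weights of [R/(I:x)], [R/I] and
    [R/(I,x)]. *)
Section MaximaExactSequence.
Variables (A S B : int -> Prop) (a r b : \bar int).
Hypotheses (Amax : is_max A a) (Smax : is_max S r) (Bmax : is_max B b).
Hypothesis S_sub : forall s, S s -> A (s - 1) \/ B s.
Hypothesis A_sub : forall s, A s -> S (s + 1) \/ B s.
Hypothesis B_sub : forall s, B s -> S s.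
Local Open Scope ereal_scope.

Lemma max_B_le : b <= r.
Proof. by apply: (is_max_least Bmax) => s /B_sub; apply: is_max_ub. Qed.

Lemma max_S_le t : a + 1%:E <= t -> b <= t -> r <= t.
Proof.
move=> at_ bt; apply: (is_max_least Smax) => s /S_sub[/(is_max_ub Amax) sa|].
  apply: le_trans at_; rewrite -[s](subrK 1%R) EFinD.
  exact: leeD2r.
by move=> /(is_max_ub Bmax) sb; apply: le_trans bt.
Qed.

Lemma max_A_le : b < a -> a + 1%:E <= r.
Proof.
(* If [A] is unbounded, an element of it beyond integer bounds of [r] and [b]
   contradicts [A_sub]. *)
have bounded (t : \bar int) : t < +oo -> exists u : int, t <= u%:E.
  by case: t => [u||] // _; [exists u | exists 0%R; apply: leNye].
case: a Amax => [m [Am _]|Ainf|_] ba; last by rewrite ltNge leNye in ba.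
  have [/(is_max_ub Smax)//|/(is_max_ub Bmax)] := A_sub Am.
  by rewrite leNgt ba.
have [u bu] := bounded b ba.
rewrite addye // leye_eq; apply: contraT; rewrite -ltey => /bounded[t rt].
have [s As] := Ainf (Num.max t u); rewrite gt_max => /andP[ts us].
have [/(is_max_ub Smax) sr|/(is_max_ub Bmax) sb] := A_sub As.
  have := le_trans sr rt; rewrite lee_fin leNgt => /negP[].
  by apply: lt_trans ts _; rewrite ltrDl.
have := le_trans sb bu; rewrite lee_fin leNgt => /negP[]; exact: us.
Qed.

End MaximaExactSequence.

Local Open Scope ereal_scope.

Theorem theorem4p7 (k : fieldType) (n : nat) (I : ideal k n) (i : 'I_n) :
  monomial_ideal I ->
  let x : {mpoly k[n]} := 'X_i%R in
  [/\ reg_quot (colon I x) > reg_quot (add_elt I x) ->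
        reg_quot I = reg_quot (colon I x) + 1%:E,
      reg_quot (colon I x) = reg_quot (add_elt I x) ->
        reg_quot I = reg_quot (add_elt I x) + 1%:E \/
        reg_quot I = reg_quot (add_elt I x)
    & reg_quot (colon I x) < reg_quot (add_elt I x) ->
        reg_quot I = reg_quot (add_elt I x)].
Proof.
move=> monI x.
have Amax := regP (@quot_deg k n (colon I x)).
have Smax := regP (@quot_deg k n I).
have Bmax := regP (@quot_deg k n (add_elt I x)).
have Ble := max_B_le Smax Bmax (@reg_set_add_elt k n I i monI).
have Sle := max_S_le Amax Smax Bmax (@reg_set_quot k n I i monI).
have Ale := max_A_le Amax Smax Bmax (@reg_set_colon k n I i monI).
rewrite /reg_quot; move: (reg _) (reg _) (reg _) Ble Sle Ale {Amax Smax Bmax}.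
move=> b r a Ble Sle Ale; split=> [ba|ab|ab].
- apply: le_anti; rewrite Ale // Sle //.
  by apply: le_trans (ltW ba) _; rewrite leeDl // lee_fin.
- move: Ble; rewrite le_eqVlt => /predU1P[<-|br]; [by right | left].
  apply: le_anti; rewrite Sle ?ab ?leeDl ?lee_fin //=.
  exact: int_succ_le.
- apply: le_anti; rewrite Ble Sle //.
  exact: int_succ_le.
Qed.
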